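(* Let $n\ge 1$ be an integer and let $\overline{2\mathbb{N}}$ denote the set of odd natural numbers. If $n$ is odd, then $$M(n,\overline{2\mathbb{N}})=\binom{n}{\lfloor n/2\rfloor},$$ and if $n$ is even, then $$M(n,\overline{2\mathbb{N}})=\frac12\binom{n}{n/2}.$$
   Context: $K_n$ is the complete graph on the vertex set $\{1,\dots,n\}$. Hamiltonian paths of $K_n$ are undirected and are regarded as (labelled) subgraphs of $K_n$. For a set $\mathbb{D}\subseteq\mathbb{N}$, two Hamiltonian paths in $K_n$ are called $\mathbb{D}$-cycle different if the union of the two paths (the graph whose edge set is the union of their edge sets) contains a cycle, not necessarily induced, whose length belongs to $\mathbb{D}$. $M(n,\mathbb{D})$ denotes the largest cardinality of a set of Hamiltonian paths in $K_n$ any two distinct members of which are $\mathbb{D}$-cycle different. *)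

(* Defs.v *)
From mathcomp Require Import all_boot all_order all_algebra.

Set Implicit Arguments.
Unset Strict Implicit.
Unset Printing Implicit Defensive.

(* A spanning subgraph of K_n is encoded by its edge set, an edge being the
   pair [set x; y] of its endpoints; the vertex set is always the whole 'I_n. *)

Definition path_edges (n : nat) (s : seq 'I_n) : {set {set 'I_n}} :=
  [set [set xy.1; xy.2] | xy in zip s (behead s)].

(* A duplicate-free n.-tuple over 'I_n visits every vertex. Taking the image
   under path_edges identifies a vertex ordering with its reversal, so the
   paths are undirected. *)
Definition hamiltonian_paths (n : nat) : {set {set {set 'I_n}}} :=
  [set path_edges s | s : n.-tuple 'I_n & uniq s].

Definition adjacent (n : nat) (E : {set {set 'I_n}}) : rel 'I_n :=
  fun x y => [set x; y] \in E.

(* ucycleb alone would accept a single edge walked back and forth as a cycle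
   of length 2, hence the bound 2 < k. A cycle in K_n has length at most n. *)
Definition has_cycle_length_in (n : nat) (D : pred nat)
    (E : {set {set 'I_n}}) : bool :=
  [exists k : 'I_n.+1, exists c : k.-tuple 'I_n,
    [&& 2 < k, D k & ucycleb (adjacent E) c]].

Definition cycle_different (n : nat) (D : pred nat)
    (P Q : {set {set 'I_n}}) : bool :=
  has_cycle_length_in D (P :|: Q).

Definition cycle_different_family (n : nat) (D : pred nat)
    (F : {set {set {set 'I_n}}}) : bool :=
  (F \subset hamiltonian_paths n) &&
  [forall P in F, forall Q in F, (P != Q) ==> cycle_different D P Q].

Definition M (n : nat) (D : pred nat) : nat :=
  \max_(F : {set {set {set 'I_n}}} | cycle_different_family D F) #|F|.

(* Main.v *)
Require Import Defs.
From mathcomp Require Import all_boot all_order all_algebra.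
From mathcomp Require Import zify.

(** A Hamiltonian path is connected and bipartite, so it has exactly two proper
    2-colourings, complementary to each other, and their classes have sizes
    floor(n/2) and ceil(n/2).

    The union of two Hamiltonian paths has an odd cycle if and only if the two
    paths have different bipartitions.  If they share a proper colouring, the
    union is bipartite and all of its cycles are even
    ([bipartite_no_odd_cycle]).  Otherwise some edge xy of the second path is
    monochromatic for the first, and the segment of the first path from x to y,
    closed up by xy, is an odd cycle ([monochromatic_edge_odd_cycle]); the
    theorem that graphs without odd cycles are bipartite is thus avoided.

    Since every balanced bipartition is that of some Hamiltonian path
    ([balanced_coloring_path]), the maximum is the number of balanced
    bipartitions ([M_odd_bipartitions]).  Each bipartition is represented by its
    class of size floor(n/2), which is determined when n is odd; when n is even
    the class containing vertex 0 is chosen, which halves the count. *)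

Set Implicit Arguments.
Unset Strict Implicit.
Unset Printing Implicit Defensive.

(** * Proper 2-colourings and the parity of cycles *)

(** A 2-colouring is given by one of its two colour classes. *)
Definition proper_coloring n (E : {set {set 'I_n}}) (S : {set 'I_n}) : bool :=
  [forall x, forall y, adjacent E x y ==> ((x \in S) != (y \in S))].

Lemma proper_coloringP n (E : {set {set 'I_n}}) (S : {set 'I_n}) :
  reflect (forall x y, adjacent E x y -> (x \in S) = ~~ (y \in S))
          (proper_coloring E S).
Proof.
apply: (iffP forallP) => [pS x y xy|pS x].
  by move/forallP: (pS x) => /(_ y) /implyP /(_ xy); do 2 case: (_ \in S).
by apply/forallP => y; apply/implyP => /pS ->; case: (_ \in S).
Qed.

Lemma proper_coloringU n (E1 E2 : {set {set 'I_n}}) S :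
  proper_coloring E1 S -> proper_coloring E2 S -> proper_coloring (E1 :|: E2) S.
Proof.
move=> /proper_coloringP p1 /proper_coloringP p2; apply/proper_coloringP => x y.
by rewrite /adjacent inE => /orP[/p1|/p2].
Qed.

Lemma proper_coloringC n (E : {set {set 'I_n}}) S :
  proper_coloring E S -> proper_coloring E (~: S).
Proof.
move=> /proper_coloringP pS; apply/proper_coloringP => x y xy.
by rewrite !inE (pS x y).
Qed.

Lemma proper_coloring_path n (E : {set {set 'I_n}}) S x p :
  proper_coloring E S -> path (adjacent E) x p ->
  (last x p \in S) = (x \in S) (+) odd (size p).
Proof.
move=> /proper_coloringP pS; elim: p x => [|y p IHp] x /= => [_|/andP[xy yp]].
  by rewrite addbF.
by rewrite IHp // (pS x y xy) addbN addNb negbK.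
Qed.

(** Colours alternate along a cycle, so going once around it back to the starting
    colour takes an even number of steps. *)
Lemma bipartite_no_odd_cycle n (E : {set {set 'I_n}}) S :
  proper_coloring E S -> ~~ has_cycle_length_in odd E.
Proof.
move=> pS; apply/existsP => -[k] /existsP[c] /and3P[k2 ok] /andP[cyc _].
case: c cyc => -[|x p] /=; first by move/eqP=> k0; rewrite -k0 in k2.
move/eqP => szc /(proper_coloring_path pS); rewrite last_rcons size_rcons szc ok.
by case: (x \in S).
Qed.

Lemma has_cycle_length_in_seq n (D : pred nat) (E : {set {set 'I_n}}) c :
  2 < size c -> D (size c) -> cycle (adjacent E) c -> uniq c ->
  has_cycle_length_in D E.
Proof.
move=> c2 Dc cyc Uc.
have szc : size c < n.+1.
  by rewrite ltnS -[n in _ <= n]card_ord -(card_uniqP Uc) max_card.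
apply/existsP; exists (Ordinal szc); apply/existsP; exists (in_tuple c).
by rewrite /= c2 Dc /ucycleb cyc Uc.
Qed.

(** * The bipartition of a Hamiltonian path *)

Section Path.
Variables (n : nat) (x0 : 'I_n) (s : n.-tuple 'I_n).

Lemma path_edgesP (e : {set 'I_n}) :
  reflect (exists2 i, i.+1 < n & e = [set nth x0 s i; nth x0 s i.+1])
          (e \in path_edges s).
Proof.
have sz : size (zip s (behead s)) = n.-1.
  by rewrite size_zip size_behead size_tuple; apply/minn_idPr/leq_pred.
have nthz i : i < n.-1 ->
    nth (x0, x0) (zip s (behead s)) i = (nth x0 s i, nth x0 s i.+1).
  by move=> i_n; rewrite nth_zip_cond sz i_n nth_behead.
apply: (iffP imsetP) => [[xy xy_s ->]|[i i_n ->]].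
  have i_n : index xy (zip s (behead s)) < n.-1 by rewrite -sz index_mem.
  exists (index xy (zip s (behead s))); first by rewrite -ltn_predRL.
  by have := nthz _ i_n; rewrite nth_index // => xyE; rewrite [in LHS]xyE.
rewrite -ltn_predRL in i_n.
by exists (nth x0 s i, nth x0 s i.+1); rewrite // -nthz // mem_nth // sz.
Qed.

Lemma path_edges_sorted : sorted (adjacent (path_edges s)) s.
Proof.
apply/(sortedP x0) => i; rewrite size_tuple => i_n.
by apply/path_edgesP; exists i.
Qed.

Lemma proper_coloring_nth S i : proper_coloring (path_edges s) S -> i < n ->
  (nth x0 s i \in S) = (nth x0 s 0 \in S) (+) odd i.
Proof.
move=> /proper_coloringP pS; elim: i => [|i IHi] i_n; first by rewrite addbF.
have/pS: adjacent (path_edges s) (nth x0 s i) (nth x0 s i.+1).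
  by apply/path_edgesP; exists i.
rewrite IHi 1?ltnW //= addbN.
by move=> ->; rewrite negbK.
Qed.

Lemma proper_coloring_alternate (S : {set 'I_n}) :
  (forall i, i.+1 < n -> (nth x0 s i.+1 \in S) = ~~ (nth x0 s i \in S)) ->
  proper_coloring (path_edges s) S.
Proof.
move=> altS; apply/proper_coloringP => x y /path_edgesP[i /altS alt_i exy].
have := set21 x y; have := set22 x y; rewrite exy !inE.
have: nth x0 s i.+1 \in [set x; y] by rewrite exy set22.
have: nth x0 s i \in [set x; y] by rewrite exy set21.
(* An edge with x = y would have a single vertex, of two different colours. *)
rewrite !inE => ei ei1 /orP[]/eqP ey /orP[]/eqP ex.
- by move: alt_i; rewrite ex ey orbb in ei1; rewrite (eqP ei1); case: (_ \in S).
- by rewrite ex ey alt_i.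
- by rewrite ex ey alt_i negbK.
- by move: alt_i; rewrite ex ey orbb in ei; rewrite (eqP ei); case: (_ \in S).
Qed.

Hypothesis Us : uniq s.

Lemma mem_hamiltonian x : x \in val s.
Proof.
suff/subsetP sub: {: 'I_n} \subset s by exact: sub.
rewrite -(subset_leqif_card (subset_predT _)).
by rewrite (card_uniqP Us) size_tuple card_ord.
Qed.

Lemma index_hamiltonian_lt x : index x s < n.
Proof. by rewrite -[n in _ < n](size_tuple s) index_mem mem_hamiltonian. Qed.

Definition odd_class : {set 'I_n} := [set x | odd (index x s)].

Lemma odd_class_proper : proper_coloring (path_edges s) odd_class.
Proof.
by apply: proper_coloring_alternate => i i_n;
  rewrite !inE !index_uniq ?size_tuple // ltnW.
Qed.

Lemma card_odd_class : #|odd_class| = n./2.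
Proof.
rewrite -sum1_card (eq_bigl (fun x => odd (index x s))) => [|x]; last first.
  by rewrite inE.
have Pbig : perm_eq (index_enum 'I_n) s.
  apply: uniq_perm; rewrite ?index_enum_uniq // => x.
  by rewrite mem_index_enum mem_hamiltonian.
rewrite (perm_big _ Pbig) /= (big_nth x0) size_tuple big_mkord.
rewrite (eq_bigl (fun i : 'I_n => odd i)) => [|i]; last first.
  by rewrite index_uniq ?size_tuple.
rewrite big_mkcond /=.
elim: (n) => [|k IHk]; first by rewrite big_ord0.
by rewrite big_ord_recr /= IHk; case: ifP; lia.
Qed.

(** A proper colouring of a path is determined by the colour of its origin. *)
Lemma proper_coloring_odd_class S : proper_coloring (path_edges s) S ->
  S = odd_class \/ S = ~: odd_class.
Proof.
move=> pS.
have inS x : (x \in S) = (nth x0 s 0 \in S) (+) odd (index x s).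
  by rewrite -(proper_coloring_nth pS (index_hamiltonian_lt x)) nth_index ?mem_hamiltonian.
case S0: (nth x0 s 0 \in S); [right|left]; apply/setP => x;
  by rewrite inS S0 !inE.
Qed.

(** The segment of the path between the ends of the edge has an odd number of
    vertices, and the edge closes it up. *)
Lemma monochromatic_edge_odd_cycle (E : {set {set 'I_n}}) x y :
  x != y -> [set x; y] \in E ->
  (x \in odd_class) = (y \in odd_class) ->
  has_cycle_length_in odd (path_edges s :|: E).
Proof.
wlog ltxy : x y / index x s < index y s => [IH|] nxy xyE.
  case: (ltngtP (index x s) (index y s)) => [/IH|/IH H cxy|ixy _]; first exact.
    by apply: H => //; rewrite 1?eq_sym // setUC.
  by rewrite -(nth_index x0 (mem_hamiltonian x)) ixy nth_index ?mem_hamiltonian ?eqxx in nxy.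
rewrite !inE => oxy.
have ltyn := index_hamiltonian_lt y.
set i := index x s in ltxy oxy; set j := index y s in ltxy oxy ltyn.
pose c := take (j - i).+1 (drop i s).
have szc : size c = (j - i).+1.
  by rewrite size_take size_drop size_tuple; case: ifP; lia.
have nthc k : k <= j - i -> nth x0 c k = nth x0 s (i + k).
  by move=> lek; rewrite nth_take // nth_drop.
(* Equal parity of the positions i < j makes j - i even and at least 2. *)
apply: (@has_cycle_length_in_seq _ _ _ c); rewrite ?szc //; [lia|lia| |]; last first.
  by rewrite take_uniq ?drop_uniq.
have sc : sorted (adjacent (path_edges s :|: E)) c.
  apply: take_sorted; apply: drop_sorted; apply: sub_sorted path_edges_sorted.
  by move=> u v; rewrite /adjacent inE => ->.
have lastc : last x0 c = y.
  by rewrite -nth_last szc nthc // subnKC 1?ltnW // nth_index ?mem_hamiltonian.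
have headc : nth x0 c 0 = x by rewrite nthc // addn0 nth_index ?mem_hamiltonian.
case: c szc sc lastc headc {nthc} => //= z p _ zp zpy zx.
by rewrite rcons_path zp zpy zx /adjacent inE setUC xyE orbT.
Qed.

End Path.

Lemma path_edge_neq n (s : n.-tuple 'I_n) x y :
  uniq s -> [set x; y] \in path_edges s -> x != y.
Proof.
move=> Us xy; move/proper_coloringP: (odd_class_proper x Us) => /(_ x y xy).
by apply: contra_eq_neq => ->; case: (_ \in _).
Qed.

(** * Representatives of balanced bipartitions *)

(** One class from each balanced bipartition: the smaller class if the number n.+1 of
    vertices is odd, the class of vertex 0 if it is even. *)
Definition balanced_classes n : {set {set 'I_n.+1}} :=
  [set S : {set 'I_n.+1} | (#|S| == n.+1./2) && (odd n.+1 || (ord0 \in S))].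

Lemma balanced_class_path n (s : n.+1.-tuple 'I_n.+1) : uniq s ->
  exists2 S, S \in balanced_classes n & proper_coloring (path_edges s) S.
Proof.
move=> Us; have pS := odd_class_proper ord0 Us.
have cS := card_odd_class ord0 Us.
case oS: (odd n.+1 || (ord0 \in odd_class s)).
  by exists (odd_class s) => //; rewrite inE cS eqxx oS.
exists (~: odd_class s); last exact: proper_coloringC.
move: oS => /negbT/norP[on]; rewrite !inE => ->; rewrite orbT andbT.
have := cardsC (odd_class s); rewrite card_ord cS; lia.
Qed.

Lemma balanced_classes_setC n (S : {set 'I_n.+1}) :
  S \in balanced_classes n -> ~: S \notin balanced_classes n.
Proof.
rewrite !inE => /andP[/eqP cS oS]; have := cardsC S; rewrite card_ord.
move: cS oS; move: #|S| #|~: S| => a b.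
by case: (ord0 \in S) => /=; lia.
Qed.

Lemma balanced_class_uniq n (s : n.+1.-tuple 'I_n.+1) (S1 S2 : {set 'I_n.+1}) :
  uniq s ->
  S1 \in balanced_classes n -> S2 \in balanced_classes n ->
  proper_coloring (path_edges s) S1 -> proper_coloring (path_edges s) S2 ->
  S1 = S2.
Proof.
move=> Us b1 b2 /(proper_coloring_odd_class ord0 Us) p1.
move=> /(proper_coloring_odd_class ord0 Us) p2.
have C1 := balanced_classes_setC b1; have C2 := balanced_classes_setC b2.
case: p1 p2 => [] e1 [] e2; rewrite e1 e2 // in b1 b2 C1 C2 *.
  by rewrite b2 in C1.
by rewrite b1 in C2.
Qed.

(** The path alternates between an enumeration of the complement of S, on even
    positions, and one of S, on odd positions. *)
Lemma balanced_coloring_path n (S : {set 'I_n.+1}) : #|S| = n.+1./2 ->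
  exists2 s : n.+1.-tuple 'I_n.+1, uniq s & proper_coloring (path_edges s) S.
Proof.
move=> cS; have cC : #|~: S| = uphalf n.+1.
  have := cardsC S; rewrite card_ord; lia.
pose f i := nth ord0 (enum (if odd i then S else ~: S)) i./2.
have lt_f i : i < n.+1 -> i./2 < size (enum (if odd i then S else ~: S)).
  by rewrite -cardE; case: ifP => oi; rewrite ?cS ?cC; lia.
have fS i : i < n.+1 -> (f i \in S) = odd i.
  move=> /lt_f/(mem_nth ord0); rewrite mem_enum -/(f i).
  by case: (odd i) => //; rewrite inE => /negbTE.
have szf : size (mkseq f n.+1) == n.+1 by rewrite size_mkseq.
exists (Tuple szf); first (apply/mkseq_uniqP => i j; rewrite !inE => i_n j_n fij).
  have oij : odd i = odd j by rewrite -!fS ?fij.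
  move/eqP: fij; rewrite /f -oij nth_uniq ?enum_uniq ?lt_f //; last first.
    by rewrite oij lt_f.
  by move/eqP; lia.
apply: (@proper_coloring_alternate _ ord0) => i i_n.
have nth_f k : k < n.+1 -> nth ord0 (Tuple szf) k = f k by exact: nth_mkseq.
by have i_n1 := ltnW i_n; rewrite !nth_f // !fS.
Qed.

(** * The maximum as a number of bipartitions *)

Lemma hamiltonian_pathsP n (P : {set {set 'I_n}}) :
  reflect (exists2 s : n.-tuple 'I_n, uniq s & P = path_edges s)
          (P \in hamiltonian_paths n).
Proof.
by apply: (iffP imsetP) => -[s Us ->]; exists s => //; move: Us; rewrite inE.
Qed.

(** A representative is never the complement of another one, so distinct S and T
    are different bipartitions: S is not proper for the second path, which thus
    has an edge inside one of the classes of the first path. *)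
Lemma distinct_bipartitions_odd_cycle n (s t : n.+1.-tuple 'I_n.+1)
    (S T : {set 'I_n.+1}) :
  uniq s -> uniq t -> S \in balanced_classes n -> T \in balanced_classes n ->
  proper_coloring (path_edges s) S -> proper_coloring (path_edges t) T ->
  S != T -> cycle_different odd (path_edges s) (path_edges t).
Proof.
move=> Us Ut bS bT pS pT nST.
have: ~~ proper_coloring (path_edges t) S.
  by apply: contra nST => ptS; apply/eqP; apply: (balanced_class_uniq Ut).
case/forallPn=> x /forallPn[y]; rewrite negb_imply negbK => /andP[xy /eqP Sxy].
apply: (monochromatic_edge_odd_cycle ord0 Us (path_edge_neq Ut xy) xy).
case: (proper_coloring_odd_class ord0 Us pS) Sxy => ->; rewrite ?inE //.
exact: negb_inj.
Qed.

Lemma M_odd_bipartitions n : M n.+1 odd = #|balanced_classes n|.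
Proof.
apply/eqP; rewrite eqn_leq; apply/andP; split.
  apply/bigmax_leqP => F /andP[/subsetP hF /forallP dF].
  (* Upper bound: paths of F with the same bipartition are not odd-cycle
     different, hence are equal. *)
  pose cls P := odflt set0
    [pick S | (S \in balanced_classes n) && proper_coloring P S].
  have clsP P : P \in F ->
      (cls P \in balanced_classes n) && proper_coloring P (cls P).
    move=> /hF/hamiltonian_pathsP[s Us ->].
    rewrite /cls; case: pickP => //= noS.
    by have [S bS pS] := balanced_class_path Us; have := noS S; rewrite bS pS.
  have inj : {in F &, injective cls}.
    move=> P Q PF QF ePQ; apply/eqP/negPn/negP => nPQ.
    move/implyP: (dF P) => /(_ PF) /forallP/(_ Q)/implyP/(_ QF)/implyP/(_ nPQ).
    apply/negP/(@bipartite_no_odd_cycle _ _ (cls P))/proper_coloringU.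
      by case/andP: (clsP _ PF).
    by rewrite ePQ; case/andP: (clsP _ QF).
  rewrite -(card_in_imset inj); apply/subset_leq_card/subsetP => _ /imsetP[P PF ->].
  by case/andP: (clsP _ PF).
(* Lower bound: one arbitrary path for each bipartition gives a valid family. *)
pose rep S := odflt set0
  [pick P | (P \in hamiltonian_paths n.+1) && proper_coloring P S].
have repP S : S \in balanced_classes n ->
    (rep S \in hamiltonian_paths n.+1) && proper_coloring (rep S) S.
  rewrite inE => /andP[/eqP/balanced_coloring_path[s Us pS] _].
  rewrite /rep; case: pickP => //= /(_ (path_edges s)); rewrite pS andbT.
  by move/negP; case; apply/hamiltonian_pathsP; exists s.
have inj : {in balanced_classes n &, injective rep}.
  move=> S T bS bT eST; case/andP: (repP S bS) => /hamiltonian_pathsP[s Us es] pS.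
  case/andP: (repP T bT) => _; rewrite -eST es in pS * => pT.
  exact: (balanced_class_uniq Us).
rewrite -(card_in_imset inj).
apply: (@leq_bigmax_cond _ _ (fun F : {set {set {set 'I_n.+1}}} => #|F|)).
apply/andP; split.
  by apply/subsetP => _ /imsetP[S bS ->]; case/andP: (repP S bS).
apply/forallP => P; apply/implyP => /imsetP[S bS ->].
apply/forallP => Q; apply/implyP => /imsetP[T bT ->]; apply/implyP => nST.
case/andP: (repP S bS) => /hamiltonian_pathsP[s Us es].
case/andP: (repP T bT) => /hamiltonian_pathsP[t Ut et].
rewrite es et => pT pS; apply: (distinct_bipartitions_odd_cycle Us Ut bS bT) => //.
by apply: contra nST => /eqP->.
Qed.

Lemma card_balanced_classes_odd n :
  odd n.+1 -> #|balanced_classes n| = 'C(n.+1, n.+1./2).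
Proof.
move=> on; rewrite -[n.+1 in RHS]card_ord -card_draws card_ord.
by apply: eq_card => S; rewrite !inE on andbT.
Qed.

(** When n.+1 is even, complementation exchanges the representatives with the other
    sets of half size. *)
Lemma card_balanced_classes_even n :
  ~~ odd n.+1 -> #|balanced_classes n|.*2 = 'C(n.+1, n.+1./2).
Proof.
move=> en; rewrite -[n.+1 in RHS]card_ord -card_draws card_ord.
rewrite -[RHS](cardsID (balanced_classes n)) -addnn; congr (_ + _).
  by apply: eq_card => S; rewrite !inE; case: eqP.
rewrite -(card_imset _ (@setC_inj _)); apply: eq_card => S.
rewrite -[S in LHS]setCK (mem_imset _ _ (@setC_inj _)) !inE (negbTE en) /=.
have := cardsC S; rewrite card_ord => cS.
have -> : (#|~: S| == n.+1./2) = (#|S| == n.+1./2) by lia.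
by case: eqP => //=; rewrite andbT.
Qed.

Theorem proposition1 (n : nat) (hn : 1 <= n) :
  (odd n -> M n odd = 'C(n, n %/ 2)) /\
  (~~ odd n -> ((M n odd)%:R = 1 / 2%:R * ('C(n, n %/ 2))%:R :> rat)%R).
Proof.
case: n hn => // n _; rewrite divn2 M_odd_bipartitions; split=> [on|en].
  exact: card_balanced_classes_odd.
rewrite -card_balanced_classes_even // -mul2n GRing.natrM GRing.mulrA.
by rewrite GRing.divfK ?GRing.mul1r.
Qed.
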